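(* Let $\mathcal{I}:\mathsf{UNITARY}\to\mathsf{aChiral}$ be the inclusion 2-functor which forgets the unitary structure, and let $\mathsf{Unitary}:\mathsf{aChiral}\to\mathsf{UNITARY}$ be the 2-functor sending an involutive category to its unitary category of pre-unitary objects. There is a 2-adjunction $$\mathsf{UNITARY}(\mathbb{U},\mathsf{Unitary}(\mathbb{X}))\simeq\mathsf{aChiral}(\mathcal{I}(\mathbb{U}),\mathbb{X}),$$ where $\mathbb{U}$ is a unitary category and $\mathbb{X}$ is an involutive category, with $\mathsf{Unitary}(\mathcal{I}(\mathbb{U}))\simeq\mathbb{U}$, making this a 2-coreflection.
   Context: Composition is written in diagrammatic order: $fg$ means first $f$, then $g$. An involutive category $(\mathbb{X},(-)^\dagger,\iota)$ is a category $\mathbb{X}$ with a functor $(-)^\dagger:\mathbb{X}^{\mathrm{op}}\to\mathbb{X}$ and a natural isomorphism $\iota_X:X\to X^{\dagger\dagger}$ such that $\iota_{X^\dagger}(\iota_X)^\dagger=1_{X^\dagger}$. An involutive functor $(F,\gamma):(\mathbb{X},(-)^\dagger,\iota)\to(\mathbb{Y},(-)^\ddagger,\iota')$ is a functor $F$ with a natural isomorphism $\gamma_X:F(X^\dagger)\to F(X)^\ddagger$ (the preservator) such that $F(\iota_X)\gamma_{X^\dagger}=\iota'_{F(X)}(\gamma_X)^\ddagger$. Composition: $(F,\gamma)(G,\gamma')=(FG,G(\gamma)\gamma')$. An achiral transformation $\alpha:(F,\gamma)\to(G,\gamma')$ is a natural transformation $\alpha:F\to G$ such that for all $X$: $\gamma_{X^\dagger}=\alpha_{X^{\dagger\dagger}}\,\gamma'_{X^\dagger}\,(\alpha_{X^\dagger})^\ddagger$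 and $(\gamma_X)^\ddagger=(\alpha_X)^{\ddagger\ddagger}\,(\gamma'_X)^\ddagger\,(\alpha_{X^\dagger})^\ddagger$. The 2-category $\mathsf{aChiral}$ has involutive categories, involutive functors and achiral transformations. A unitary category is an involutive category with a family of isomorphisms $\varphi_X:X\to X^\dagger$ (not assumed natural) such that $\varphi_{X^\dagger}=(\varphi_X^{-1})^\dagger$ and $\varphi_X\varphi_{X^\dagger}=\iota_X$. A unitary functor is an involutive functor $(F,\gamma)$ between unitary categories with $F(\varphi_X)\gamma_X=\varphi_{F(X)}$ for all $X$. The 2-category $\mathsf{UNITARY}$ has unitary categories, unitary functors and achiral transformations. For an involutive category $\mathbb{X}$, the unitary category $\mathsf{Unitary}(\mathbb{X})$ has as objects the pre-unitary objects, i.e. pairs $(X,h)$ with $h:X\to X^\dagger$ an isomorphism such that $h(h^{-1})^\dagger=\iota_X$; maps $(X,h)\to(Y,h')$ are all maps $X\to Y$ of $\mathbb{X}$; the involution is $(X,h)^\dagger=(X^\dagger,(h^{-1})^\dagger)$ on objects, and on maps and for $\iota$ it is as in $\mathbb{X}$; the unitary structure map of $(X,h)$ is $h$. On an involutive functor $(F,\gamma)$, $\mathsf{Unitary}$ sends $(X,h)$ to $(F(X),F(h)\gamma_X)$ and otherwise acts as $(F,\gamma)$; on 2-cells it acts by the same components.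
   Formalization: The equivalence Unitary(I(U)) ≃ U and the 2-coreflection are taken in aChiral: the unit is a unitary functor whose image under I is an equivalence. An equivalence in UNITARY fails, e.g. for Z/2 as a one-object category with trivial dagger, iota, phi and the pre-unitary h = -1. *)

(* Defs.v *)
From Stdlib Require Import ssreflect.
From Stdlib Require Import FunctionalExtensionality ProofIrrelevance.

Set Implicit Arguments.
Unset Strict Implicit.
Unset Printing Implicit Defensive.

Declare Scope cat_scope.
Open Scope cat_scope.

#[local] Obligation Tactic := simpl; intros; try reflexivity.

Record Category : Type := MkCategory {
  Ob :> Type;
  Hom : Ob -> Ob -> Type;
  idm : forall A, Hom A A;
  comp : forall A B C, Hom A B -> Hom B C -> Hom A C;
  comp_idl : forall A B (f : Hom A B), comp (idm A) f = f;
  comp_idr : forall A B (f : Hom A B), comp f (idm B) = f;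
  comp_assoc : forall A B C D (f : Hom A B) (g : Hom B C) (h : Hom C D),
    comp (comp f g) h = comp f (comp g h)
}.
Arguments Hom {c} _ _.
Arguments idm {c} A.
Arguments comp {c A B C} f g.

(* Diagrammatic order: [f ;; g] is first [f], then [g]. *)
Notation "f ;; g" := (comp f g) (at level 50, left associativity) : cat_scope.

Record iso (C : Category) (A B : C) : Type := MkIso {
  fwd :> Hom A B;
  bwd : Hom B A;
  fwd_bwd : fwd ;; bwd = idm A;
  bwd_fwd : bwd ;; fwd = idm B
}.

Record Functor (C D : Category) : Type := MkFunctor {
  fob :> C -> D;
  fmap : forall A B : C, Hom A B -> Hom (fob A) (fob B);
  fmap_id : forall A : C, fmap (idm A) = idm (fob A);
  fmap_comp : forall (A B E : C) (f : Hom A B) (g : Hom B E),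
    fmap (f ;; g) = fmap f ;; fmap g
}.
Arguments fmap {C D} _ {A B} _.

Definition op (C : Category) : Category :=
  @MkCategory C (fun A B => @Hom C B A) (fun A => idm A)
    (fun A B E f g => @comp C E B A g f)
    (fun A B f => comp_idr f) (fun A B f => comp_idl f)
    (fun A B E F f g h => eq_sym (comp_assoc h g f)).

Definition idF (C : Category) : Functor C C :=
  @MkFunctor C C (fun A => A) (fun A B f => f)
    (fun A => eq_refl) (fun A B E f g => eq_refl).

Program Definition compF (C D E : Category) (F : Functor C D) (G : Functor D E) :
    Functor C E :=
  @MkFunctor C E (fun A => G (F A)) (fun A B f => fmap G (fmap F f)) _ _.
Next Obligation. by rewrite !fmap_id. Qed.
Next Obligation. by rewrite !fmap_comp. Qed.

Program Definition constF (C D : Category) (d : D) : Functor C D :=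
  @MkFunctor C D (fun _ => d) (fun _ _ _ => idm d) _ _.
Next Obligation. by rewrite comp_idl. Qed.

Program Definition prodC (C D : Category) : Category :=
  @MkCategory (C * D)
    (fun A B => (Hom (fst A) (fst B) * Hom (snd A) (snd B))%type)
    (fun A => (idm (fst A), idm (snd A)))
    (fun A B E f g => (fst f ;; fst g, snd f ;; snd g)) _ _ _.
Next Obligation. by case: f => f g; rewrite /= !comp_idl. Qed.
Next Obligation. by case: f => f g; rewrite /= !comp_idr. Qed.
Next Obligation. by rewrite !comp_assoc. Qed.

Program Definition pairF (E C D : Category) (F : Functor E C) (G : Functor E D) :
    Functor E (prodC C D) :=
  @MkFunctor E (prodC C D) (fun A => (F A, G A)) (fun A B f => (fmap F f, fmap G f)) _ _.
Next Obligation. by rewrite !fmap_id. Qed.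
Next Obligation. by rewrite !fmap_comp. Qed.

Definition fstF (C D : Category) : Functor (prodC C D) C :=
  @MkFunctor (prodC C D) C (fun A => fst A) (fun A B f => fst f)
    (fun A => eq_refl) (fun A B E f g => eq_refl).

Definition sndF (C D : Category) : Functor (prodC C D) D :=
  @MkFunctor (prodC C D) D (fun A => snd A) (fun A B f => snd f)
    (fun A => eq_refl) (fun A B E f g => eq_refl).

Definition prodF (C C' D D' : Category) (F : Functor C C') (G : Functor D D') :
    Functor (prodC C D) (prodC C' D') :=
  pairF (compF (fstF C D) F) (compF (sndF C D) G).

Definition assocF (B C D : Category) :
    Functor (prodC (prodC B C) D) (prodC B (prodC C D)) :=
  pairF (compF (fstF _ _) (fstF _ _))
        (pairF (compF (fstF _ _) (sndF _ _)) (sndF _ _)).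

(* A (strict) 2-category as a Cat-enriched category: the unit and associativity
   laws are equalities of functors between hom-categories, so that they cover
   1-cells and 2-cells at once and need no transport. *)
Record TwoCategory : Type := MkTwoCategory {
  cell0 :> Type;
  hom : cell0 -> cell0 -> Category;
  one : forall a, hom a a;
  hcomp : forall a b c, Functor (prodC (hom a b) (hom b c)) (hom a c);
  hcomp_idl : forall a b,
    compF (pairF (constF (hom a b) (one a)) (idF (hom a b))) (hcomp a a b)
    = idF (hom a b);
  hcomp_idr : forall a b,
    compF (pairF (idF (hom a b)) (constF (hom a b) (one b))) (hcomp a b b)
    = idF (hom a b);
  hcomp_assoc : forall a b c d,
    compF (prodF (hcomp a b c) (idF (hom c d))) (hcomp a c d)
    = compF (assocF (hom a b) (hom b c) (hom c d))
        (compF (prodF (idF (hom a b)) (hcomp b c d)) (hcomp a b d))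
}.
Arguments hom {t} a b.
Arguments one {t} a.
Arguments hcomp {t} a b c.

Record TwoFunctor (K M : TwoCategory) : Type := MkTwoFunctor {
  cell0_map :> K -> M;
  hom_map : forall a b : K, Functor (hom a b) (hom (cell0_map a) (cell0_map b));
  hom_map_one : forall a : K, hom_map a a (one a) = one (cell0_map a);
  hom_map_hcomp : forall a b c : K,
    compF (hcomp a b c) (hom_map a c)
    = compF (prodF (hom_map a b) (hom_map b c)) (hcomp _ _ _)
}.
Arguments hom_map {K M} _ a b.

(* A (strict) 2-adjunction [L -| R]: isomorphisms of hom-categories
   K(a, R x) ~ M(L a, x), 2-natural in [a] and [x]. *)
Record TwoAdjunction (K M : TwoCategory) (L : TwoFunctor K M) (R : TwoFunctor M K) :
    Type := MkTwoAdjunction {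
  transpose : forall (a : K) (x : M), Functor (hom a (R x)) (hom (L a) x);
  untranspose : forall (a : K) (x : M), Functor (hom (L a) x) (hom a (R x));
  transposeK : forall a x, compF (transpose a x) (untranspose a x) = idF _;
  untransposeK : forall a x, compF (untranspose a x) (transpose a x) = idF _;
  transpose_natl : forall (b a : K) (x : M),
    compF (hcomp b a (R x)) (transpose b x)
    = compF (prodF (hom_map L b a) (transpose a x)) (hcomp (L b) (L a) x);
  transpose_natr : forall (a : K) (x y : M),
    compF (compF (prodF (idF (hom a (R x))) (hom_map R x y)) (hcomp a (R x) (R y)))
      (transpose a y)
    = compF (prodF (transpose a x) (idF (hom x y))) (hcomp (L a) x y)
}.

Definition adj_unit (K M : TwoCategory) (L : TwoFunctor K M) (R : TwoFunctor M K)
    (adj : TwoAdjunction L R) (a : K) : hom a (R (L a)) :=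
  untranspose adj a (L a) (one (L a)).

Definition is_equivalence (K : TwoCategory) (a b : K) (f : hom a b) : Prop :=
  exists g : hom b a,
    inhabited (iso (hcomp a b a (f, g)) (one a)) /\
    inhabited (iso (hcomp b a b (g, f)) (one b)).

(* The coreflection condition asks that the unit a -> R(L a) become an
   equivalence under L, rather than in K itself. For the inclusion of unitary
   categories the latter fails: a 2-cell [s] between unitary functors F, G
   satisfies uphi (F A) = s A ;; uphi (G A) ;; dag (s A), so that an equivalence
   in UNITARY would make every pre-unitary object (A, h) isomorphic to some
   (B, uphi B) compatibly with h and uphi B; this is false for the group Z/2 as
   a one-object unitary category with trivial involution, iota and uphi. *)
Definition is_two_coreflection (K M : TwoCategory) (L : TwoFunctor K M)
    (R : TwoFunctor M K) (adj : TwoAdjunction L R) : Prop :=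
  forall a : K, is_equivalence (hom_map L a (R (L a)) (adj_unit adj a)).

Definition contramap (C D : Category) (F : Functor (op C) D) (A B : C) (f : Hom A B) :
    Hom (F B) (F A) := @fmap (op C) D F B A f.

Record InvCat : Type := MkInvCat {
  icat :> Category;
  dagF : Functor (op icat) icat;
  iota : forall A : icat, iso A (dagF (dagF A));
  iota_nat : forall (A B : icat) (f : Hom A B),
    f ;; iota B = iota A ;; contramap dagF (contramap dagF f);
  iota_dag : forall A : icat,
    iota (dagF A) ;; contramap dagF (iota A) = idm (dagF A)
}.

Definition dob (X : InvCat) (A : X) : X := dagF X A.
Definition dag (X : InvCat) (A B : X) (f : Hom A B) : Hom (dob B) (dob A) :=
  contramap (dagF X) f.

Lemma dag_id (X : InvCat) (A : X) : dag (idm A) = idm (dob A).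
Proof. exact (@fmap_id _ _ (dagF X) A). Qed.

Lemma dag_comp (X : InvCat) (A B C : X) (f : Hom A B) (g : Hom B C) :
  dag (f ;; g) = dag g ;; dag f.
Proof. exact (@fmap_comp _ _ (dagF X) C B A g f). Qed.

Lemma dag_inj (X : InvCat) (A B : X) (f g : Hom A B) : dag f = dag g -> f = g.
Proof.
move=> e.
have h : f ;; iota B = g ;; iota B.
  by rewrite !iota_nat -/(dag f) -/(dag g) e.
by rewrite -(comp_idr f) -(comp_idr g) -(fwd_bwd (iota B)) -!comp_assoc h.
Qed.

Definition id_iso (C : Category) (A : C) : iso A A :=
  MkIso (comp_idl (idm A)) (comp_idl (idm A)).

Program Definition comp_iso (C : Category) (A B E : C) (f : iso A B) (g : iso B E) :
    iso A E :=
  @MkIso C A E (f ;; g) (bwd g ;; bwd f) _ _.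
Next Obligation. by rewrite comp_assoc -(comp_assoc g) fwd_bwd comp_idl fwd_bwd. Qed.
Next Obligation. by rewrite comp_assoc -(comp_assoc (bwd f)) bwd_fwd comp_idl bwd_fwd. Qed.

Program Definition fmap_iso (C D : Category) (F : Functor C D) (A B : C) (f : iso A B) :
    iso (F A) (F B) :=
  @MkIso D (F A) (F B) (fmap F f) (fmap F (bwd f)) _ _.
Next Obligation. by rewrite -fmap_comp fwd_bwd fmap_id. Qed.
Next Obligation. by rewrite -fmap_comp bwd_fwd fmap_id. Qed.

(* [(h^-1)^dag], with inverse [h^dag]. *)
Program Definition dag_inv (X : InvCat) (A B : X) (h : iso A B) : iso (dob A) (dob B) :=
  @MkIso X (dob A) (dob B) (dag (bwd h)) (dag h) _ _.
Next Obligation. by rewrite -dag_comp fwd_bwd dag_id. Qed.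
Next Obligation. by rewrite -dag_comp bwd_fwd dag_id. Qed.

(* [gam] is the preservator. *)
Record InvFunctor (X Y : InvCat) : Type := MkInvFunctor {
  ifun :> Functor X Y;
  gam : forall A : X, iso (ifun (dob A)) (dob (ifun A));
  gam_nat : forall (A B : X) (f : Hom A B),
    fmap ifun (dag f) ;; gam A = gam B ;; dag (fmap ifun f);
  gam_iota : forall A : X,
    fmap ifun (iota A) ;; gam (dob A) = iota (ifun A) ;; dag (gam A)
}.

Record Achiral (X Y : InvCat) (F G : InvFunctor X Y) : Type := MkAchiral {
  tr :> forall A : X, Hom (F A) (G A);
  tr_nat : forall (A B : X) (f : Hom A B), fmap F f ;; tr B = tr A ;; fmap G f;
  tr_achiral1 : forall A : X,
    fwd (gam F (dob A)) = tr (dob (dob A)) ;; gam G (dob A) ;; dag (tr (dob A));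
  tr_achiral2 : forall A : X,
    dag (gam F A) = dag (dag (tr A)) ;; dag (gam G A) ;; dag (tr (dob A))
}.

(* Together the two achirality conditions are equivalent to this single one,
   because the involution is faithful. *)
Lemma achiral_gam (X Y : InvCat) (F G : InvFunctor X Y) (t : Achiral F G) (A : X) :
  fwd (gam F A) = t (dob A) ;; gam G A ;; dag (t A).
Proof. by apply: dag_inj; rewrite !dag_comp -comp_assoc (tr_achiral2 t). Qed.

Program Definition achiral_of_gam (X Y : InvCat) (F G : InvFunctor X Y)
    (t : forall A : X, Hom (F A) (G A))
    (tn : forall (A B : X) (f : Hom A B), fmap F f ;; t B = t A ;; fmap G f)
    (tg : forall A : X, fwd (gam F A) = t (dob A) ;; gam G A ;; dag (t A)) :
    Achiral F G :=
  @MkAchiral X Y F G t tn _ _.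
Next Obligation. exact: tg. Qed.
Next Obligation. by rewrite tg !dag_comp -comp_assoc. Qed.

Lemma achiral_eq (X Y : InvCat) (F G : InvFunctor X Y) (s t : Achiral F G) :
  (forall A, s A = t A) -> s = t.
Proof.
case: s t => [s ? ? ?] [t ? ? ?] /= e.
have {}e : s = t by apply: functional_extensionality_dep.
by subst t; f_equal; apply: proof_irrelevance.
Qed.

Program Definition achiral_id (X Y : InvCat) (F : InvFunctor X Y) : Achiral F F :=
  @achiral_of_gam X Y F F (fun A => idm (F A)) _ _.
Next Obligation. by rewrite comp_idl comp_idr. Qed.
Next Obligation. by rewrite dag_id comp_idl comp_idr. Qed.

Program Definition achiral_comp (X Y : InvCat) (F G H : InvFunctor X Y)
    (s : Achiral F G) (t : Achiral G H) : Achiral F H :=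
  @achiral_of_gam X Y F H (fun A => s A ;; t A) _ _.
Next Obligation. by rewrite -comp_assoc (tr_nat s) comp_assoc (tr_nat t) comp_assoc. Qed.
Next Obligation. by rewrite (achiral_gam s) (achiral_gam t) dag_comp !comp_assoc. Qed.

Program Definition aChiral_hom (X Y : InvCat) : Category :=
  @MkCategory (InvFunctor X Y) (@Achiral X Y) (@achiral_id X Y) (@achiral_comp X Y) _ _ _.
Next Obligation. by apply: achiral_eq => a /=; rewrite comp_idl. Qed.
Next Obligation. by apply: achiral_eq => a /=; rewrite comp_idr. Qed.
Next Obligation. by apply: achiral_eq => a /=; rewrite comp_assoc. Qed.

Definition invfun_id (X : InvCat) : InvFunctor X X.
Proof.
refine (@MkInvFunctor X X (idF X) (fun A => id_iso (dob A)) _ _).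
- by move=> A B f /=; rewrite comp_idl comp_idr.
- by move=> A /=; rewrite dag_id !comp_idr.
Defined.

Definition invfun_comp (X Y Z : InvCat) (F : InvFunctor X Y) (G : InvFunctor Y Z) :
  InvFunctor X Z.
Proof.
refine (@MkInvFunctor X Z (compF F G)
  (fun A => comp_iso (fmap_iso G (gam F A)) (gam G (F A))) _ _).
- move=> A B f /=.
  by rewrite -comp_assoc -fmap_comp gam_nat fmap_comp comp_assoc gam_nat !comp_assoc.
- move=> A /=.
  rewrite -comp_assoc -fmap_comp gam_iota fmap_comp dag_comp -comp_assoc.
  by rewrite -gam_iota !comp_assoc gam_nat.
Defined.

Definition achiral_hcomp (X Y Z : InvCat) (F F' : InvFunctor X Y) (G G' : InvFunctor Y Z)
    (s : Achiral F F') (t : Achiral G G') : Achiral (invfun_comp F G) (invfun_comp F' G').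
Proof.
refine (@achiral_of_gam X Z (invfun_comp F G) (invfun_comp F' G')
  (fun A => fmap G (s A) ;; t (F' A)) _ _).
- move=> A B f /=.
  by rewrite -comp_assoc -fmap_comp (tr_nat s) fmap_comp comp_assoc (tr_nat t) comp_assoc.
- move=> A /=.
  rewrite (achiral_gam s) !fmap_comp !comp_assoc gam_nat (achiral_gam t) dag_comp !comp_assoc.
  by rewrite -(comp_assoc (fmap G (gam F' A))) (tr_nat t) !comp_assoc.
Defined.

(* The map induced by an equality of objects, through which equalities of
   functors are expressed. *)
Definition eqhom (C : Category) (A B : C) (e : A = B) : Hom A B :=
  match e in _ = B return Hom A B with eq_refl => idm A end.

Lemma eqhom_id (C : Category) (A : C) (e : A = A) : eqhom e = idm A.
Proof. by rewrite (proof_irrelevance _ e eq_refl). Qed.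

Lemma functor_eq (C D : Category) (F G : Functor C D) (e : forall A, F A = G A) :
  (forall (A B : C) (f : Hom A B),
     fmap F f ;; eqhom (e B) = eqhom (e A) ;; fmap G f) -> F = G.
Proof.
case: F G e => [Fo Fm Fi Fc] [Go Gm Gi Gc] /= e.
have e' : Fo = Go by apply: functional_extensionality_dep.
subst Go => h.
have e' : Fm = Gm.
  apply: functional_extensionality_dep => A.
  apply: functional_extensionality_dep => B.
  apply: functional_extensionality_dep => f.
  by move: (h A B f); rewrite !eqhom_id comp_idl comp_idr.
by subst Gm; f_equal; apply: proof_irrelevance.
Qed.

Lemma iso_eq (C : Category) (A B : C) (f g : iso A B) : fwd f = fwd g -> f = g.
Proof.
case: f g => [f f' ff' f'f] [g g' gg' g'g] /= e; subst g.
have e : f' = g' by rewrite -(comp_idl f') -g'g comp_assoc ff' comp_idr.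
by subst g'; f_equal; apply: proof_irrelevance.
Qed.

Lemma invfun_eq (X Y : InvCat) (F G : InvFunctor X Y) (e : forall A, F A = G A) :
  (forall (A B : X) (f : Hom A B),
     fmap F f ;; eqhom (e B) = eqhom (e A) ;; fmap G f) ->
  (forall A : X,
     fwd (gam F A) = eqhom (e (dob A)) ;; gam G A ;; dag (eqhom (e A))) ->
  F = G.
Proof.
case: F G e => [F g gn gi] [G g' gn' gi'] /= e h1 h2.
have e' : F = G := functor_eq h1.
subst G.
have e' : g = g'.
  apply: functional_extensionality_dep => A; apply: iso_eq.
  by rewrite h2 !eqhom_id dag_id comp_idl comp_idr.
by subst g'; f_equal; apply: proof_irrelevance.
Qed.

Lemma tr_eqhom (X Y : InvCat) (F G : aChiral_hom X Y) (e : F = G) (A : X) :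
  tr (eqhom e) A = eqhom (f_equal (fun K : InvFunctor X Y => K A) e).
Proof. by subst G. Qed.

Lemma achiral_functor_eq (C : Category) (X Y : InvCat) (F G : Functor C (aChiral_hom X Y))
    (e : forall c, F c = G c) :
  (forall (c d : C) (f : Hom c d) (A : X)
     (eA : forall c, fob (F c) A = fob (G c) A),
     tr (fmap F f) A ;; eqhom (eA d) = eqhom (eA c) ;; tr (fmap G f) A) ->
  F = G.
Proof.
move=> h; apply: (functor_eq (e := e)) => c d f.
apply: achiral_eq => A /=; rewrite !tr_eqhom.
exact: (h c d f A (fun c => f_equal (fun K : InvFunctor X Y => K A) (e c))).
Qed.

Definition aChiral_hcomp (X Y Z : InvCat) :
  Functor (prodC (aChiral_hom X Y) (aChiral_hom Y Z)) (aChiral_hom X Z).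
Proof.
refine (@MkFunctor (prodC (aChiral_hom X Y) (aChiral_hom Y Z)) (aChiral_hom X Z)
  (fun p => invfun_comp (fst p) (snd p))
  (fun p q s => achiral_hcomp (fst s) (snd s)) _ _).
- by move=> [F G]; apply: achiral_eq => A /=; rewrite fmap_id comp_idl.
- move=> [F G] [F' G'] [F'' G''] [s t] [s' t']; apply: achiral_eq => A /=.
  by rewrite fmap_comp !comp_assoc -(comp_assoc _ (t _)) (tr_nat t) !comp_assoc.
Defined.

Lemma invfun_comp_idl (X Y : InvCat) (F : InvFunctor X Y) :
  invfun_comp (invfun_id X) F = F.
Proof.
apply: (@invfun_eq _ _ (invfun_comp (invfun_id X) F) F (fun _ => eq_refl)) => /=.
- by move=> A B f; rewrite comp_idl comp_idr.
- by move=> A; rewrite dag_id fmap_id comp_idr.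
Qed.

Lemma invfun_comp_idr (X Y : InvCat) (F : InvFunctor X Y) :
  invfun_comp F (invfun_id Y) = F.
Proof.
apply: (@invfun_eq _ _ (invfun_comp F (invfun_id Y)) F (fun _ => eq_refl)) => /=.
- by move=> A B f; rewrite comp_idl comp_idr.
- by move=> A; rewrite dag_id comp_idl.
Qed.

Lemma invfun_comp_assoc (X Y Z W : InvCat) (F : InvFunctor X Y) (G : InvFunctor Y Z)
    (H : InvFunctor Z W) :
  invfun_comp (invfun_comp F G) H = invfun_comp F (invfun_comp G H).
Proof.
apply: (@invfun_eq _ _ (invfun_comp (invfun_comp F G) H) (invfun_comp F (invfun_comp G H))
  (fun _ => eq_refl)) => /=.
- by move=> A B f; rewrite comp_idl comp_idr.
- by move=> A; rewrite dag_id fmap_comp comp_idl comp_idr comp_assoc.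
Qed.

Definition aChiral : TwoCategory.
Proof.
refine (@MkTwoCategory InvCat aChiral_hom invfun_id aChiral_hcomp _ _ _).
- move=> X Y.
  apply: achiral_functor_eq => [F|F G s A eA] /=.
    exact: invfun_comp_idl.
  by rewrite !eqhom_id fmap_id !comp_idl comp_idr.
- move=> X Y.
  apply: achiral_functor_eq => [F|F G s A eA] /=.
    exact: invfun_comp_idr.
  by rewrite !eqhom_id comp_idl !comp_idr.
- move=> X Y Z W.
  apply: achiral_functor_eq => [[[F G] H]|[[F G] H] [[F' G'] H'] [[s t] u] A eA] /=.
    exact: invfun_comp_assoc.
  by rewrite !eqhom_id comp_idl comp_idr fmap_comp comp_assoc.
Defined.

Record UnitaryCat : Type := MkUnitaryCat {
  ucat :> InvCat;
  uphi : forall A : ucat, iso A (dob A);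
  uphi_dag : forall A : ucat, fwd (uphi (dob A)) = dag (bwd (uphi A));
  uphi_iota : forall A : ucat, uphi A ;; uphi (dob A) = iota A
}.

Record UnitaryFunctor (U V : UnitaryCat) : Type := MkUnitaryFunctor {
  ufun :> InvFunctor U V;
  ufun_phi : forall A : U, fmap ufun (uphi A) ;; gam ufun A = uphi (ufun A)
}.

Definition UNITARY_hom (U V : UnitaryCat) : Category :=
  @MkCategory (UnitaryFunctor U V) (fun F G => Achiral F G)
    (fun F => achiral_id F) (fun F G H s t => achiral_comp s t)
    (fun F G s => @comp_idl (aChiral_hom U V) F G s)
    (fun F G s => @comp_idr (aChiral_hom U V) F G s)
    (fun F G H K s t u => @comp_assoc (aChiral_hom U V) F G H K s t u).

Definition forget_hom (U V : UnitaryCat) : Functor (UNITARY_hom U V) (aChiral_hom U V) :=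
  @MkFunctor (UNITARY_hom U V) (aChiral_hom U V) (fun F => ufun F) (fun F G s => s)
    (fun F => eq_refl) (fun F G H s t => eq_refl).

Definition ufun_id (U : UnitaryCat) : UnitaryFunctor U U.
Proof. by refine (@MkUnitaryFunctor U U (invfun_id U) _) => A /=; rewrite comp_idr. Defined.

Definition ufun_comp (U V W : UnitaryCat) (F : UnitaryFunctor U V) (G : UnitaryFunctor V W) :
  UnitaryFunctor U W.
Proof.
refine (@MkUnitaryFunctor U W (invfun_comp F G) _) => A /=.
by rewrite -comp_assoc -fmap_comp ufun_phi ufun_phi.
Defined.

Definition UNITARY_hcomp (U V W : UnitaryCat) :
  Functor (prodC (UNITARY_hom U V) (UNITARY_hom V W)) (UNITARY_hom U W) :=
  @MkFunctor (prodC (UNITARY_hom U V) (UNITARY_hom V W)) (UNITARY_hom U W)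
    (fun p => ufun_comp (fst p) (snd p))
    (fun p q s => achiral_hcomp (fst s) (snd s))
    (fun p => @fmap_id _ _ (aChiral_hcomp U V W) (ufun (fst p), ufun (snd p)))
    (fun p q r s t => @fmap_comp _ _ (aChiral_hcomp U V W)
       (ufun (fst p), ufun (snd p)) (ufun (fst q), ufun (snd q))
       (ufun (fst r), ufun (snd r)) s t).

Lemma ufun_eq (U V : UnitaryCat) (F G : UnitaryFunctor U V) : ufun F = ufun G -> F = G.
Proof.
case: F G => [F p] [G q] /= e; subst G.
by f_equal; apply: proof_irrelevance.
Qed.

Lemma tr_ueqhom (U V : UnitaryCat) (F G : UNITARY_hom U V) (e : F = G) (A : U) :
  tr (eqhom e) A = eqhom (f_equal (fun K : UnitaryFunctor U V => K A) e).
Proof. by subst G. Qed.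

Lemma unitary_functor_eq (C : Category) (U V : UnitaryCat) (F G : Functor C (UNITARY_hom U V))
    (e : forall c, F c = G c) :
  (forall (c d : C) (f : Hom c d) (A : U) (eA : forall c, fob (F c) A = fob (G c) A),
     tr (fmap F f) A ;; eqhom (eA d) = eqhom (eA c) ;; tr (fmap G f) A) ->
  F = G.
Proof.
move=> h; apply: (functor_eq (e := e)) => c d f.
apply: achiral_eq => A /=; rewrite !tr_ueqhom.
exact: (h c d f A (fun c => f_equal (fun K : UnitaryFunctor U V => K A) (e c))).
Qed.

Definition UNITARY : TwoCategory.
Proof.
refine (@MkTwoCategory UnitaryCat UNITARY_hom ufun_id UNITARY_hcomp _ _ _).
- move=> U V.
  apply: unitary_functor_eq => [F|F G s A eA] /=.
    by apply: ufun_eq; apply: invfun_comp_idl.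
  by rewrite !eqhom_id fmap_id !comp_idl comp_idr.
- move=> U V.
  apply: unitary_functor_eq => [F|F G s A eA] /=.
    by apply: ufun_eq; apply: invfun_comp_idr.
  by rewrite !eqhom_id comp_idl !comp_idr.
- move=> U V W T.
  apply: unitary_functor_eq => [[[F G] H]|[[F G] H] [[F' G'] H'] [[s t] u] A eA] /=.
    by apply: ufun_eq; apply: invfun_comp_assoc.
  by rewrite !eqhom_id comp_idl comp_idr fmap_comp comp_assoc.
Defined.

Definition Inclusion : TwoFunctor UNITARY aChiral.
Proof.
refine (@MkTwoFunctor UNITARY aChiral ucat forget_hom _ _); first by [].
move=> U V W.
by apply: achiral_functor_eq => [p|p q s A eA] //=; rewrite !eqhom_id comp_idl comp_idr.
Defined.

Record PreUnitary (X : InvCat) : Type := MkPreUnitary {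
  pob : X;
  pmap : iso pob (dob pob);
  pmap_iota : pmap ;; dag (bwd pmap) = iota pob
}.

Definition Unitary_cat (X : InvCat) : Category :=
  @MkCategory (PreUnitary X) (fun P Q => Hom (pob P) (pob Q))
    (fun P => idm (pob P)) (fun P Q R f g => f ;; g)
    (fun P Q f => comp_idl f) (fun P Q f => comp_idr f)
    (fun P Q R S f g h => comp_assoc f g h).

Definition pre_dag (X : InvCat) (P : PreUnitary X) : PreUnitary X.
Proof.
refine (@MkPreUnitary X (dob (pob P)) (dag_inv (pmap P)) _) => /=.
set h := pmap P.
have e : iota (dob (pob P)) ;; (dag (dag (bwd h)) ;; dag h) = idm (dob (pob P)).
  by rewrite -dag_comp pmap_iota; apply: iota_dag.
rewrite -[LHS]comp_idl -e !comp_assoc -(comp_assoc (dag h)) -dag_comp bwd_fwd dag_id.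
by rewrite comp_idl -dag_comp -dag_comp bwd_fwd !dag_id comp_idr.
Defined.

Definition pre_iso (X : InvCat) (P Q : Unitary_cat X) (f : iso (pob P) (pob Q)) : iso P Q :=
  @MkIso (Unitary_cat X) P Q (fwd f) (bwd f) (fwd_bwd f) (bwd_fwd f).

Definition Unitary_dag (X : InvCat) : Functor (op (Unitary_cat X)) (Unitary_cat X) :=
  @MkFunctor (op (Unitary_cat X)) (Unitary_cat X) (@pre_dag X)
    (fun P Q f => dag f)
    (fun P => dag_id (pob P)) (fun P Q R f g => dag_comp g f).

Definition Unitary_inv (X : InvCat) : InvCat :=
  @MkInvCat (Unitary_cat X) (Unitary_dag X)
    (fun P => @pre_iso X P (pre_dag (pre_dag P)) (iota (pob P)))
    (fun P Q f => iota_nat f) (fun P => iota_dag (pob P)).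

Definition Unitary_ob (X : InvCat) : UnitaryCat :=
  @MkUnitaryCat (Unitary_inv X) (fun P => @pre_iso X P (pre_dag P) (pmap P))
    (fun P => eq_refl) (fun P => pmap_iota P).

Definition pre_map (X Y : InvCat) (F : InvFunctor X Y) (P : PreUnitary X) : PreUnitary Y.
Proof.
refine (@MkPreUnitary Y (F (pob P)) (comp_iso (fmap_iso F (pmap P)) (gam F (pob P))) _) => /=.
set h := pmap P.
have e : fmap F (dag (bwd h)) ;; gam F (dob (pob P)) = gam F (pob P) ;; dag (fmap F (bwd h)).
  exact: gam_nat.
rewrite dag_comp comp_assoc -(comp_assoc (gam F (pob P))) -e -!comp_assoc -fmap_comp.
by rewrite pmap_iota gam_iota comp_assoc -dag_comp bwd_fwd dag_id comp_idr.
Defined.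

Definition Unitary_fun (X Y : InvCat) (F : InvFunctor X Y) :
    Functor (Unitary_cat X) (Unitary_cat Y) :=
  @MkFunctor (Unitary_cat X) (Unitary_cat Y) (pre_map F) (fun P Q f => fmap F f)
    (fun P => fmap_id F (pob P)) (fun P Q R f g => fmap_comp F f g).

Definition Unitary_invfun (X Y : InvCat) (F : InvFunctor X Y) :
    InvFunctor (Unitary_inv X) (Unitary_inv Y) :=
  @MkInvFunctor (Unitary_inv X) (Unitary_inv Y) (Unitary_fun F)
    (fun P => @pre_iso Y (pre_map F (pre_dag P)) (pre_dag (pre_map F P)) (gam F (pob P)))
    (fun P Q f => gam_nat F f) (fun P => gam_iota F (pob P)).

Definition Unitary_ufun (X Y : InvCat) (F : InvFunctor X Y) :
    UnitaryFunctor (Unitary_ob X) (Unitary_ob Y) :=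
  @MkUnitaryFunctor (Unitary_ob X) (Unitary_ob Y) (Unitary_invfun F) (fun P => eq_refl).

Definition Unitary_achiral (X Y : InvCat) (F G : InvFunctor X Y) (s : Achiral F G) :
    Achiral (Unitary_invfun F) (Unitary_invfun G) :=
  @MkAchiral (Unitary_inv X) (Unitary_inv Y) (Unitary_invfun F) (Unitary_invfun G)
    (fun P => s (pob P)) (fun P Q f => tr_nat s f)
    (fun P => tr_achiral1 s (pob P)) (fun P => tr_achiral2 s (pob P)).

Definition Unitary_hom (X Y : InvCat) :
  Functor (aChiral_hom X Y) (UNITARY_hom (Unitary_ob X) (Unitary_ob Y)).
Proof.
refine (@MkFunctor (aChiral_hom X Y) (UNITARY_hom (Unitary_ob X) (Unitary_ob Y))
  (@Unitary_ufun X Y) (@Unitary_achiral X Y) _ _).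
- by move=> F; apply: achiral_eq.
- by move=> F G H s t; apply: achiral_eq.
Defined.

Lemma preunitary_eq (X : InvCat) (P Q : PreUnitary X) (e : pob P = pob Q) :
  pmap P ;; dag (eqhom (eq_sym e)) = eqhom e ;; pmap Q -> P = Q.
Proof.
case: P Q e => [A h p] [B k q] /= e; subst B => /=.
rewrite dag_id comp_idl comp_idr => /iso_eq e; subst k.
by f_equal; apply: proof_irrelevance.
Qed.

(* The map of X underlying a map of Unitary(X) induced by an equality. *)
Lemma pre_eqhom (X : InvCat) (P Q : Unitary_cat X) (e : P = Q) :
  @eqhom (Unitary_cat X) P Q e = eqhom (f_equal (@pob X) e).
Proof. by subst Q. Qed.

Lemma Unitary_invfun_eq (Z X : InvCat) (F G : InvFunctor Z (Unitary_inv X))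
    (e : forall A, F A = G A) :
  (forall (A B : Z) (f : Hom A B) (eA : forall A, pob (F A) = pob (G A)),
     @comp X _ _ _ (fmap F f) (eqhom (eA B)) = @comp X _ _ _ (eqhom (eA A)) (fmap G f)) ->
  (forall (A : Z) (eA : forall A, pob (F A) = pob (G A)),
     fwd (gam F A)
     = @comp X _ _ _ (@comp X _ _ _ (eqhom (eA (dob A))) (gam G A)) (@dag X _ _ (eqhom (eA A)))) ->
  F = G.
Proof.
move=> h1 h2; apply: (invfun_eq (e := e)) => [A B f|A]; rewrite !pre_eqhom.
  exact: (h1 A B f (fun A => f_equal (@pob X) (e A))).
exact: (h2 A (fun A => f_equal (@pob X) (e A))).
Qed.

Definition Unitary : TwoFunctor aChiral UNITARY.
Proof.
refine (@MkTwoFunctor aChiral UNITARY Unitary_ob Unitary_hom _ _).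
- move=> X; apply: ufun_eq; apply: Unitary_invfun_eq => [P|P Q f eA|P eA] /=.
  + apply: (@preunitary_eq X (pre_map (invfun_id X) P) P eq_refl) => /=.
    by rewrite dag_id comp_idl !comp_idr.
  + by rewrite !eqhom_id comp_idl comp_idr.
  + by rewrite !eqhom_id dag_id !comp_idl.
- move=> X Y Z; apply: unitary_functor_eq => [[F G]|[F G] [F' G'] [s t] P eP] /=.
  + apply: ufun_eq; apply: Unitary_invfun_eq => [P|P Q f eA|P eA] /=.
    * apply: (@preunitary_eq Z (pre_map (invfun_comp F G) P) (pre_map G (pre_map F P)) eq_refl) => /=.
      by rewrite dag_id comp_idl comp_idr fmap_comp comp_assoc.
    * by rewrite !eqhom_id comp_idl comp_idr.
    * by rewrite !eqhom_id dag_id comp_idl comp_idr.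
  + by rewrite !pre_eqhom !eqhom_id comp_idl comp_idr.
Defined.

(* Main.v *)
(** The counit at [X] is the involutive functor [(A, h) |-> A] and the unit at
    [U] is the unitary functor [A |-> (A, uphi A)]; transposition in either
    direction is whiskering with one of them. The composite
    [(A, h) |-> (A, uphi A)] has identity preservators, so the identities of
    the underlying objects form an achiral isomorphism onto the identity
    functor: achirality does not see the unitary structures. Hence the
    inclusion turns the unit into an equivalence. *)

From Stdlib Require Import ssreflect.
Require Import Defs.

Set Implicit Arguments.
Unset Strict Implicit.
Unset Printing Implicit Defensive.

Definition preunitary_forget (X : InvCat) : InvFunctor (Unitary_inv X) X.
Proof.
unshelve refine (@MkInvFunctor (Unitary_inv X) X
  (@MkFunctor (Unitary_cat X) X (@pob X) (fun P Q f => f)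
     (fun P => eq_refl) (fun P Q R f g => eq_refl))
  (fun P => id_iso (dob (pob P))) _ _).
- by move=> P Q f /=; rewrite comp_idl comp_idr.
- by move=> P /=; rewrite dag_id !comp_idr.
Defined.

Definition uphi_preunitary (U : UnitaryCat) (A : U) : PreUnitary U.
Proof.
by refine (@MkPreUnitary U A (uphi A) _); rewrite -uphi_dag uphi_iota.
Defined.

(** The pairs [uphi_preunitary (dob A)] and [pre_dag (uphi_preunitary A)] share their underlying
    object but agree in structure map only through [uphi_dag]. Maps of [Unitary_inv U] ignore
    structure maps, so the identity of [dob A] serves as preservator and no transport along that
    equality is needed. *)
Definition uphi_invfun (U : UnitaryCat) : InvFunctor U (Unitary_inv U).
Proof.
unshelve refine (@MkInvFunctor U (Unitary_inv U)
  (@MkFunctor U (Unitary_cat U) (@uphi_preunitary U) (fun A B f => f)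
     (fun A => eq_refl) (fun A B C f g => eq_refl))
  (fun A => @pre_iso U (uphi_preunitary (dob A)) (pre_dag (uphi_preunitary A))
     (id_iso (dob A))) _ _).
- by move=> A B f /=; rewrite comp_idl comp_idr.
(* This [dag] belongs to [Unitary_inv U] and matches that of [U] only up to conversion, hence the
   explicit pattern. *)
- by move=> A /=; rewrite [dag _](dag_id (dob A)) !comp_idr.
Defined.

Definition uphi_ufun (U : UnitaryCat) : UnitaryFunctor U (Unitary_ob U).
Proof.
by refine (@MkUnitaryFunctor U (Unitary_ob U) (uphi_invfun U) _) => A /=; rewrite comp_idr.
Defined.

Definition transpose_functor (U : UnitaryCat) (X : InvCat) :
  Functor (UNITARY_hom U (Unitary_ob X)) (aChiral_hom U X).
Proof.
refine (@MkFunctor (UNITARY_hom U (Unitary_ob X)) (aChiral_hom U X)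
  (fun F => invfun_comp F (preunitary_forget X))
  (fun F G s => achiral_hcomp s (achiral_id (preunitary_forget X))) _ _).
- by move=> F; apply: achiral_eq => A /=; rewrite comp_idr.
- by move=> F G H s t; apply: achiral_eq => A /=; rewrite !comp_idr.
Defined.

Definition untranspose_functor (U : UnitaryCat) (X : InvCat) :
  Functor (aChiral_hom U X) (UNITARY_hom U (Unitary_ob X)).
Proof.
refine (@MkFunctor (aChiral_hom U X) (UNITARY_hom U (Unitary_ob X))
  (fun F => ufun_comp (uphi_ufun U) (Unitary_ufun F))
  (fun F G s => achiral_hcomp (achiral_id (uphi_ufun U)) (Unitary_achiral s)) _ _).
- by move=> F; apply: achiral_eq => A /=; rewrite fmap_id comp_idl.
- by move=> F G H s t; apply: achiral_eq => A /=; rewrite !fmap_id !comp_idl.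
Defined.

(** Equal pairs in [Unitary_cat X] need not be convertible, while their underlying objects often
    are. Moving the coherence maps down to [X] makes them loops, which [eqhom_id] removes. *)
Lemma Unitary_functor_eq (C : Category) (U : UnitaryCat) (X : InvCat)
    (F G : Functor C (UNITARY_hom U (Unitary_ob X))) (e : forall c, F c = G c) :
  (forall (c d : C) (f : Hom c d) (A : U)
     (eA : forall c, pob (fob (F c) A) = pob (fob (G c) A)),
     @comp X _ _ _ (tr (fmap F f) A) (eqhom (eA d))
     = @comp X _ _ _ (eqhom (eA c)) (tr (fmap G f) A)) ->
  F = G.
Proof.
move=> h; apply: (unitary_functor_eq e) => c d f A eA.
rewrite !pre_eqhom.
exact: (h c d f A (fun c => f_equal (@pob X) (eA c))).
Qed.

(** The round trip replaces the structure map of [F A] by [fmap F (uphi A) ;; gam F A], up to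
    identities; that this is the original one is exactly unitarity of [F]. *)
Lemma transpose_functorK (U : UnitaryCat) (X : InvCat) :
  compF (transpose_functor U X) (untranspose_functor U X) = idF _.
Proof.
apply: Unitary_functor_eq => [F|F G s A eA] /=.
- apply: ufun_eq; apply: Unitary_invfun_eq => [A|A B f eA|A eA] /=.
  + apply: (@preunitary_eq X
      (pre_map (invfun_comp F (preunitary_forget X)) (uphi_preunitary A)) (F A) eq_refl) => /=.
    rewrite dag_id comp_idl !comp_idr.
    exact: (ufun_phi F A).
  + by rewrite !eqhom_id comp_idl comp_idr.
  + by rewrite !eqhom_id dag_id fmap_id !comp_idl !comp_idr.
- by rewrite !eqhom_id fmap_id !comp_idl !comp_idr.
Qed.

Lemma untranspose_functorK (U : UnitaryCat) (X : InvCat) :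
  compF (untranspose_functor U X) (transpose_functor U X) = idF _.
Proof.
apply: achiral_functor_eq => [F|F G s A eA] /=.
- apply: (@invfun_eq _ _
    (invfun_comp (ufun_comp (uphi_ufun U) (Unitary_ufun F)) (preunitary_forget X)) F
    (fun _ => eq_refl)) => [A B f|A] /=.
  + by rewrite comp_idl comp_idr.
  + by rewrite dag_id fmap_id !comp_idl !comp_idr.
- by rewrite !eqhom_id fmap_id !comp_idl !comp_idr.
Qed.

Definition inclusion_Unitary_adjunction : TwoAdjunction Inclusion Unitary.
Proof.
refine (@MkTwoAdjunction UNITARY aChiral Inclusion Unitary
  transpose_functor untranspose_functor transpose_functorK untranspose_functorK _ _).
- move=> V U X; apply: achiral_functor_eq => [[F G]|[F G] [F' G'] [s t] A eA] /=.
  (* Transposition is postcomposition with the counit, so naturality in the unitary category is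
     associativity. *)
  + exact: invfun_comp_assoc.
  + by rewrite !eqhom_id comp_idl !comp_idr.
- move=> U X Y; apply: achiral_functor_eq => [[F G]|[F G] [F' G'] [s t] A eA] /=.
  (* On 1-cells, naturality in the involutive category is that of the counit: applying
     [Unitary_ufun G] and then forgetting is forgetting and then applying [G]. *)
  + apply: (@invfun_eq _ _
      (invfun_comp (ufun_comp F (Unitary_ufun G)) (preunitary_forget Y))
      (invfun_comp (invfun_comp F (preunitary_forget X)) G) (fun _ => eq_refl)) => [A B f|A] /=.
    * by rewrite comp_idl comp_idr.
    * by rewrite dag_id fmap_comp fmap_id !comp_idl !comp_idr.
  + by rewrite !eqhom_id comp_idl !comp_idr.
Defined.

Lemma iso_of_eq (C : Category) (A B : C) : A = B -> inhabited (iso A B).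
Proof. by move=> <-; constructor; apply: id_iso. Qed.

Definition uphi_reflection (U : UnitaryCat) :
  Achiral (invfun_comp (preunitary_forget U) (uphi_invfun U)) (invfun_id (Unitary_inv U)).
Proof.
refine (@achiral_of_gam (Unitary_inv U) (Unitary_inv U)
  (invfun_comp (preunitary_forget U) (uphi_invfun U)) (invfun_id (Unitary_inv U))
  (fun P => idm (pob P)) _ _).
- by move=> P Q f /=; rewrite comp_idl comp_idr.
- by move=> P /=; rewrite [dag _](dag_id (pob P)) !comp_idr.
Defined.

Definition uphi_reflection_inv (U : UnitaryCat) :
  Achiral (invfun_id (Unitary_inv U)) (invfun_comp (preunitary_forget U) (uphi_invfun U)).
Proof.
refine (@achiral_of_gam (Unitary_inv U) (Unitary_inv U)
  (invfun_id (Unitary_inv U)) (invfun_comp (preunitary_forget U) (uphi_invfun U))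
  (fun P => idm (pob P)) _ _).
- by move=> P Q f /=; rewrite comp_idl comp_idr.
- by move=> P /=; rewrite [dag _](dag_id (pob P)) !comp_idr.
Defined.

(** The unit is [uphi_ufun U] followed by the image of an identity under [Unitary], which only adds
    identity factors to structure maps and preservators. *)
Lemma adj_unit_uphi (U : UnitaryCat) :
  hom_map Inclusion U (Unitary (Inclusion U)) (adj_unit inclusion_Unitary_adjunction U)
  = uphi_invfun U.
Proof.
rewrite /adj_unit /=.
apply: Unitary_invfun_eq => [A|A B f eA|A eA] /=.
- apply: (@preunitary_eq U
    (pre_map (invfun_id U) (uphi_preunitary A)) (uphi_preunitary A) eq_refl) => /=.
  by rewrite dag_id comp_idl !comp_idr.
- by rewrite !eqhom_id comp_idl comp_idr.
- by rewrite !eqhom_id dag_id !comp_idl.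
Qed.

Theorem proposition3p8 :
  exists adj : TwoAdjunction Inclusion Unitary, is_two_coreflection adj.
Proof.
exists inclusion_Unitary_adjunction => U.
(* The quasi-inverse lives in [aChiral]: it need not be unitary, since [pmap P] may differ from
   [uphi (pob P)]. *)
rewrite adj_unit_uphi; exists (preunitary_forget U); split.
(* This composite is strictly the identity; the other one changes structure maps and is the identity
   only up to [uphi_reflection]. *)
- apply: iso_of_eq => /=.
  apply: (@invfun_eq _ _
    (invfun_comp (uphi_invfun U) (preunitary_forget U)) (invfun_id U) (fun _ => eq_refl)) => [A B f|A] /=.
  + by rewrite comp_idl comp_idr.
  + by rewrite dag_id !comp_idl.
- constructor.
  apply: (@MkIso (aChiral_hom (Unitary_inv U) (Unitary_inv U))
    (invfun_comp (preunitary_forget U) (uphi_invfun U)) (invfun_id (Unitary_inv U))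
    (uphi_reflection U) (uphi_reflection_inv U)).
  + by apply: achiral_eq => P /=; rewrite comp_idl.
  + by apply: achiral_eq => P /=; rewrite comp_idl.
Qed.
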